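(* Let $(X,f)$ be a topological dynamical system with $X$ non-empty and let $\psi\in C(X,\mathbb{R})$ with $\psi>0$. Then $$P_\psi(0)=\dim_{BS}X,$$ where $P_\psi(0)$ is the $\psi$-induced topological pressure of the zero function and $\dim_{BS}X$ is the BS dimension of $X$ (with respect to $\psi$).
   Context: A topological dynamical system (TDS) $(X,f)$ is a compact metric space $(X,d)$ together with a continuous map $f:X\to X$. $C(X,\mathbb{R})$ is the space of continuous real-valued functions on $X$ with the supremum norm. For $n\ge 1$, $(S_n\varphi)(x)=\sum_{i=0}^{n-1}\varphi(f^i x)$. Here $\mathbb{N}=\{1,2,\dots\}$. For $n\in\mathbb{N}$, $d_n(x,y)=\max\{d(f^i(x),f^i(y)): i=0,\dots,n-1\}$ and $B_n(x,\epsilon)=\{y\in X: d_n(x,y)<\epsilon\}$. For $Z\subseteq X$ and $\epsilon>0$, a set $F_n\subset X$ is an $(n,\epsilon)$-spanning set of $Z$ if for every $y\in Z$ there is $x\in F_n$ with $d_n(x,y)\le\epsilon$. Induced topological pressure: let $\varphi,\psi\in C(X,\mathbb{R})$ with $\psi>0$. For $T>0$ put $$S_T=\{n\in\mathbb{N}: \exists x\in X \text{ such that } S_n\psi(x)\le T \text{ and } S_{n+1}\psi(x)>T\},$$ and for $n\in S_T$ put $X_n=\{x\in X: S_n\psi(x)\le T \text{ and } S_{n+1}\psi(x)>T\}$ (which depends on $T$; $S_T$ is a finite set). Let $$Q_{\psi,T}(f,\varphi,\epsilon)=\inf\Big\{\sum_{n\in S_T}\sum_{x\in F_n}\exp\big((S_n\varphi)(x)\big):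 F_n \text{ is an } (n,\epsilon)\text{-spanning set of } X_n \text{ for each } n\in S_T\Big\}.$$ The $\psi$-induced topological pressure of $\varphi$ (with respect to $f$) is $$P_\psi(\varphi)=\lim_{\epsilon\to0}\limsup_{T\to\infty}\frac1T\log Q_{\psi,T}(f,\varphi,\epsilon),$$ where the limit in $\epsilon$ exists (possibly $+\infty$) by monotonicity. BS dimension: for $n\ge1$, $\epsilon>0$ let $\mathcal{W}_n(\epsilon)=\{B_n(x,\epsilon): x\in X\}$. For $B=B_n(x,\epsilon)\in\mathcal{W}_n(\epsilon)$ (regarded as carrying its order $n$) put $\psi(B)=\sup_{y\in B}(S_n\psi)(y)$. A family $\mathcal{G}\subset\bigcup_{j\ge N}\mathcal{W}_j(\epsilon)$ covers $X$ if $\bigcup_{B\in\mathcal{G}}B=X$. For $\alpha>0$, $N\in\mathbb{N}$, $\epsilon>0$ define $$M(\alpha,\epsilon,N)=\inf_{\mathcal{G}}\sum_{B\in\mathcal{G}}\exp(-\alpha\psi(B)),$$ the infimum being over all finite $\mathcal{G}\subset\bigcup_{j\ge N}\mathcal{W}_j(\epsilon)$ that cover $X$. This is nondecreasing in $N$; let $m(\alpha,\epsilon)=\lim_{N\to\infty}M(\alpha,\epsilon,N)$ and $$\dim_{BS}(X,\epsilon)=\inf\{\alpha>0: m(\alpha,\epsilon)=0\}=\sup\{\alpha>0: m(\alpha,\epsilon)=\infty\}$$ (with $\inf\emptyset=\infty$, $\sup\emptyset=0$). The BS dimension is $\dim_{BS}X=\lim_{\epsilon\to0}\dim_{BS}(X,\epsilon)$;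 the limit exists (possibly $+\infty$) by monotonicity in $\epsilon$. *)

(* Defs.v *)
From HB Require Import structures.
From mathcomp Require Import all_boot all_order all_algebra.
From mathcomp Require Import all_classical all_reals all_analysis.
From mathcomp Require Import metric_structure.

Set Implicit Arguments.
Unset Strict Implicit.
Unset Printing Implicit Defensive.

Import Order.TTheory GRing.Theory Num.Theory.
Import numFieldNormedType.Exports.

Local Open Scope classical_set_scope.
Local Open Scope ring_scope.

Section InducedPressure.
Context {R : realType} {X : metricType R} (f : X -> X).

Definition birkhoff_sum (phi : X -> R) (n : nat) (x : X) : R :=
  \sum_(i < n) phi (iter i f x).

(* The neutral value 0 is harmless: distances are nonnegative. *)
Definition dyn_dist (n : nat) (x y : X) : R :=
  \big[Num.max/0]_(i < n) mdist (iter i f x) (iter i f y).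

Definition dyn_ball (n : nat) (x : X) (eps : R) : set X :=
  [set y | dyn_dist n x y < eps].

Definition spanning_set (n : nat) (eps : R) (Z F : set X) : Prop :=
  forall y, Z y -> exists2 x, F x & dyn_dist n x y <= eps.

Definition exit_set (psi : X -> R) (T : R) (n : nat) : set X :=
  [set x | birkhoff_sum psi n x <= T /\ T < birkhoff_sum psi n.+1 x].

(* Times are positive integers, so n = 0 is excluded. *)
Definition exit_times (psi : X -> R) (T : R) : set nat :=
  [set n | (0 < n)%N /\ exit_set psi T n !=set0].

(* The sets F n may be infinite; the sum of positive terms is then +oo. *)
Definition pressure_sum (psi phi : X -> R) (T eps : R) : \bar R :=
  ereal_inf [set (\esum_(n in exit_times psi T)
                    \esum_(x in F n) (expR (birkhoff_sum phi n x))%:E)%E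
            | F in [set F : nat -> set X | forall n, exit_times psi T n ->
                      spanning_set n eps (exit_set psi T n) (F n)]].

(* [limf_esup] is a limsup along a filter, here the filter of T --> +oo in R.
   The limit in eps exists in \bar R by monotonicity. *)
Definition induced_pressure (psi phi : X -> R) : \bar R :=
  lim (limf_esup (fun T : R => (T^-1)%:E * lne (pressure_sum psi phi T eps))%E
                 (pinfty_nbhs R)
       @[eps --> 0^'+]).

(* Pairs (n, B) where B is a dynamical ball of order n: a ball is kept together
   with its order, since distinct orders may give the same subset of X. *)
Definition ordered_balls (eps : R) (N : nat) : set (nat * set X) :=
  [set B | [/\ (0 < B.1)%N, (N <= B.1)%N &
               exists x, B.2 = dyn_ball B.1 x eps]].

Definition ball_weight (psi : X -> R) (B : nat * set X) : R :=
  sup [set birkhoff_sum psi B.1 y | y in B.2].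

Definition finite_cover (eps : R) (N : nat) (G : set (nat * set X)) : Prop :=
  [/\ finite_set G, G `<=` ordered_balls eps N &
      \bigcup_(B in G) B.2 = [set: X]].

Definition BS_premeasure (psi : X -> R) (alpha eps : R) (N : nat) : \bar R :=
  ereal_inf [set (\sum_(B \in G) expR (- alpha * ball_weight psi B))%:E
            | G in finite_cover eps N].

(* The limit exists in \bar R, the sequence being nondecreasing in N. *)
Definition BS_measure (psi : X -> R) (alpha eps : R) : \bar R :=
  lim (BS_premeasure psi alpha eps N @[N --> \oo]).

Definition BS_dim_at (psi : X -> R) (eps : R) : \bar R :=
  ereal_inf [set alpha%:E
            | alpha in [set alpha : R | 0 < alpha /\
                                        BS_measure psi alpha eps = 0%E]].

(* The limit exists in \bar R by monotonicity in eps. *)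
Definition BS_dim (psi : X -> R) : \bar R :=
  lim (BS_dim_at psi eps @[eps --> 0^'+]).

End InducedPressure.

(* Main.v *)
Require Import Defs.
From mathcomp Require Import all_boot all_order all_algebra finmap.
From mathcomp Require Import all_classical all_reals all_analysis.
From mathcomp Require Import metric_structure.
From mathcomp Require Import ring lra.

(** The theorem compares two ways of measuring complexity at the level [T] of
    the Birkhoff sums of [psi]: the number of spanning points needed on the
    exit sets, and the Carathéodory sums of covers by dynamical balls weighted
    by [expR (- alpha * weight)]. By compactness, [0 < m <= psi <= M]. Both
    quantities at radius [e] are nonincreasing in [e], so that both limits are
    suprema over [e > 0] (lemma [lim_nonincreasing_at_right0]) and it is enough
    to compare them at nearby radii.

    The dimension is at most the pressure ([BS_dim_at_le_pressure_at]). The exit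
    sets of a large level [T] cover the space, hence spanning sets for them give
    a cover by dynamical balls. A ball that meets an exit set has weight at
    least [T - M], so if the spanning sets have at most [expR (s * T)]
    points the sum of the cover is at most
    [expR (s * T) * expR (- alpha * (T - M))], which tends to 0 when
    [s < alpha].

    The pressure is at most the dimension ([pressure_at_le_BS_measure]). If the
    measure with exponent [alpha] vanishes, some finite cover has sum at most 1.
    Coding orbits by their itineraries through this cover, the number of words
    needed for orbits whose Birkhoff sum stays below [T] is at most exponential
    in [alpha * T], because the sum over the letters is at most 1
    ([sublevel_small_cover]). The weight of a ball is a supremum, so it exceeds
    the Birkhoff sum of a given point of the ball by up to the oscillation
    [gamma] of [psi] at the scale of the balls per unit of time; as at most
    [T / m] units of time elapse, this multiplies the exponent by
    [1 + gamma / m]. Uniform continuity makes [gamma] as small as desired when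
    the radius tends to 0. *)

Set Implicit Arguments.
Unset Strict Implicit.
Unset Printing Implicit Defensive.

Import Order.TTheory GRing.Theory Num.Theory.
Import numFieldNormedType.Exports.

Local Open Scope classical_set_scope.
Local Open Scope ring_scope.

(** * Sums and limits *)

Lemma sum_undup_le (R : numDomainType) (I : eqType) (s : seq I) (g : I -> R) :
  (forall i, 0 <= g i) -> \sum_(i <- undup s) g i <= \sum_(i <- s) g i.
Proof.
move=> g0; elim: s => [|a s IH]; first by rewrite !big_nil.
rewrite /= big_cons; case: ifP => _; first by rewrite ler_wpDl.
by rewrite big_cons lerD2l.
Qed.

Lemma ler_sum_const (R : numDomainType) (I : eqType) (s : seq I) (g : I -> R) c :
  (forall i, i \in s -> g i <= c) -> \sum_(i <- s) g i <= (size s)%:R * c.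
Proof.
elim: s => [|a s IH] H; first by rewrite big_nil mul0r.
rewrite big_cons /= -natr1 mulrDl mul1r addrC lerD// ?H ?mem_head//.
by apply: IH => i si; rewrite H// in_cons si orbT.
Qed.

Lemma esum_le_card (R : realType) (I : choiceType) (A : set I) (t : seq I)
    (a : I -> \bar R) (c : R) :
  A `<=` [set` t] -> 0 <= c -> (forall i, A i -> a i <= c%:E)%E ->
  (\esum_(i in A) a i <= ((size t)%:R * c)%:E)%E.
Proof.
move=> At c0 ac; apply: ge_ereal_sup => _ [B [finB BA]] <-.
rewrite fsbig_finite//=.
have : (\sum_(i <- fset_set B) a i <= \sum_(i <- fset_set B) c%:E)%E.
  rewrite big_seq [leRHS]big_seq; apply: lee_sum => i.
  by rewrite in_fset_set// inE => /BA /ac.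
move=> /le_trans; apply.
rewrite sumEFin lee_fin; apply: le_trans (ler_sum_const (c := c) _) _ => //.
rewrite ler_wpM2r// ler_nat uniq_leq_size// => i.
by rewrite in_fset_set// inE => /BA /At.
Qed.

Lemma esum1_le_finite (R : realType) (I : choiceType) (A : set I) (c : R) :
  (\esum_(i in A) 1%:E <= c%:E)%E ->
  exists2 t : seq I, A = [set` t] & (size t)%:R <= c.
Proof.
move=> Ac.
have card_le (B : {fset I}) : [set` B] `<=` A -> (#|` B|)%:R <= c.
  move=> BA; rewrite -lee_fin; apply: le_trans Ac.
  apply: esum_ge; exists [set` B]; first by split.
  rewrite fsbig_finite// set_fsetK sumEFin lee_fin.
  by rewrite (big_const_seq) count_predT iter_addr_0.
have [finA|infA] := pselect (finite_set A).
  exists (fset_set A); first by rewrite fset_setK.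
  by apply: card_le; rewrite fset_setK.
have [B BA] := infinite_set_fset (Num.truncn c).+1 infA.
move=> cB; have := le_trans (_ : (Num.truncn c).+1%:R <= _) (card_le _ BA).
by rewrite ler_nat leNgt truncnS_gt => /(_ cB).
Qed.

Lemma lne_leP (R : realType) (x : \bar R) (r : R) :
  (lne x <= r%:E)%E = (x <= (expR r)%:E)%E.
Proof.
case: x => [x| |] /=; rewrite ?leye_eq//; last by rewrite !leNye.
case: ifPn => [x0|]; first by rewrite leNye lee_fin (le_trans x0)// expR_ge0.
by rewrite -ltNge => x0; rewrite !lee_fin -ler_expR lnK.
Qed.

Lemma lne_ltP (R : realType) (x : \bar R) (r : R) :
  (lne x < r%:E)%E = (x < (expR r)%:E)%E.
Proof.
case: x => [x| |] /=; rewrite ?ltNye//.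
case: ifPn => [x0|]; first by rewrite ltNyr lte_fin (le_lt_trans x0)// expR_gt0.
by rewrite -ltNge => x0; rewrite !lte_fin -ltr_expR lnK.
Qed.

Section limf_esup_near.
Context {R : realType}.
Implicit Types f g : R -> \bar R.
Local Notation F := (pinfty_nbhs R).

Lemma limf_esup_le_near f (c : \bar R) :
  (\forall x \near F, f x <= c)%E -> (limf_esup f F <= c)%E.
Proof.
move=> fc; apply: le_trans (_ : ereal_sup (f @` [set x | f x <= c]%E) <= _)%E.
  by apply: ereal_inf_lbound; exists [set x | f x <= c]%E.
by apply: ge_ereal_sup => _ [x xc <-].
Qed.

Lemma limf_esup_lt_near f (c : \bar R) :
  (limf_esup f F < c)%E -> (\forall x \near F, f x < c)%E.
Proof.
move=> /ereal_inf_lt[_ [V FV <-]] Vc; apply: filterS FV => x Vx.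
by apply: le_lt_trans Vc; apply: ereal_sup_ubound; exists x.
Qed.

Lemma le_limf_esup_near f g :
  (\forall x \near F, f x <= g x)%E -> (limf_esup f F <= limf_esup g F)%E.
Proof.
move=> fg; apply: le_ereal_inf_tmp => _ [V FV <-].
apply: limf_esup_le_near; near=> x.
apply: (@le_trans _ _ (g x)); first by near: x.
by apply: ereal_sup_ubound; exists x => //; near: x.
Unshelve. all: by end_near. Qed.

Lemma limf_esup_ge_near f (c : \bar R) :
  (\forall x \near F, c <= f x)%E -> (c <= limf_esup f F)%E.
Proof.
move=> cf; apply: le_ereal_inf_tmp => _ [V FV <-].
have /filter_ex[x [cx Vx]] : \forall x \near F, (c <= f x)%E /\ V x.
  by near=> x; split; near: x.
by apply: le_trans cx _; apply: ereal_sup_ubound; exists x.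
Unshelve. all: by end_near. Qed.

End limf_esup_near.

(** Both sides of the theorem are such limits, so they are compared radius by
    radius, without any convergence argument. *)
Lemma lim_nonincreasing_at_right0 (R : realType) (h : R -> \bar R) :
  (forall d e, 0 < d -> d <= e -> (h e <= h d)%E) ->
  lim (h e @[e --> 0^'+]) = ereal_sup (h @` [set e | 0 < e]).
Proof.
move=> hdec.
have posE : [set` Interval (BRight 0) +oo%O] = [set e : R | 0 < e].
  by apply/seteqP; split=> e /=; rewrite in_itv/= andbT.
rewrite -posE; apply: cvg_lim => //; apply: nonincreasing_at_right_cvge => //.
by move=> d e; rewrite !in_itv/= !andbT => d0 _; exact: hdec.
Qed.

Lemma near_affine_le_expR (R : realType) (a b eta : R) : 0 < eta -> 0 <= b ->
  0 <= a -> \forall T \near +oo, (a * T + 1) * b <= expR (eta * T).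
Proof.
move=> eta0 b0 a0; pose h := eta / 2; have h0 : 0 < h by rewrite divr_gt0.
near=> T.
have T0 : 0 < T by near: T; exact: nbhs_pinfty_gt.
have -> : eta * T = h * T + h * T by rewrite /h; lra.
rewrite expRD.
(* The square of a linear lower bound of [expR] beats any affine function. *)
have lin : 1 + h * T <= expR (h * T) by exact: expR_ge1Dx.
have hT : a / h * b + b <= 1 + h * T.
  rewrite -lerBlDl -ler_pdivrMl//; near: T; apply: nbhs_pinfty_ge.
apply: (@le_trans _ _ ((1 + h * T) * (1 + h * T))); last first.
  by rewrite ler_pM// ?addr_ge0// mulr_ge0// ltW.
apply: (@le_trans _ _ ((1 + h * T) * (a / h * b + b))); last first.
  by rewrite ler_wpM2l// addr_ge0// mulr_ge0// ltW.
have -> : (1 + h * T) * (a / h * b + b) =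
          (a * T + 1) * b + (a / h * b + h * T * b) by field; rewrite gt_eqF.
by rewrite lerDl addr_ge0// !mulr_ge0// ?invr_ge0// ltW.
Unshelve. all: by end_near. Qed.

(** * Birkhoff sums and dynamical distances *)

Lemma compact_uniform_continuity (R : realType) (X : metricType R)
    (g : X -> R) (gamma : R) :
  compact [set: X] -> continuous g -> 0 < gamma ->
  exists2 delta, 0 < delta &
    forall x y, mdist x y < delta -> `|g x - g y| <= gamma.
Proof.
move=> /compact_near_coveringP cX cg gamma0.
have /cX near_unif : forall x, [set: X] x -> \forall x' \near x & e \near 0^'+,
    forall y, mdist x' y < e -> `|g x' - g y| <= gamma.
  move=> x _.
  have /nbhs_ballP[d /= d0 xd] : \forall z \near x, `|g x - g z| < gamma / 2.
    by have /cvgrPdist_lt := cg x; apply; rewrite divr_gt0.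
  exists (ball x (d / 2), [set e | e < d / 2]) => /=.
    split; first by apply: nbhsx_ballx; rewrite divr_gt0.
    by apply: nbhs_right_lt; rewrite divr_gt0.
  move=> [x' e]/= [xx' ed] y x'y.
  have gx' : `|g x - g x'| < gamma / 2.
    by apply: xd; apply: le_ball xx'; rewrite ler_pdivrMr// ler_pMr// ler1n.
  have gy : `|g x - g y| < gamma / 2.
    apply: xd; rewrite (splitr d); apply: ball_triangle xx' _.
    by rewrite ballEmdist/=; exact: lt_trans ed.
  rewrite (splitr gamma) ltW// (le_lt_trans (ler_distD (g x) _ _))//.
  by rewrite ltrD// distrC.
near (0 : R)^'+ => delta; exists delta; first by near: delta; exact: nbhs_right_gt.
have H : [set: X] `<=` [set x' | forall y, mdist x' y < delta ->
                          `|g x' - g y| <= gamma] by near: delta; exact: near_unif.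
by move=> x y; exact: H.
Unshelve. all: by end_near. Qed.

Section Dynamics.
Context {R : realType} {X : metricType R} (f : X -> X).
Implicit Types (psi : X -> R) (x y z : X) (n k : nat) (e : R).

Lemma dyn_dist_leP n x y e : 0 <= e ->
  dyn_dist f n x y <= e <->
  (forall i, (i < n)%N -> mdist (iter i f x) (iter i f y) <= e).
Proof.
move=> e0; split => [/bigmax_leP[_ xy] i ni|xy]; first exact: xy (Ordinal ni) _.
by apply/bigmax_leP; split => // i _; exact: xy.
Qed.

Lemma dyn_dist_ltP n x y e : 0 < e ->
  dyn_dist f n x y < e <->
  (forall i, (i < n)%N -> mdist (iter i f x) (iter i f y) < e).
Proof.
move=> e0; split => [/bigmax_ltP[_ xy] i ni|xy]; first exact: xy (Ordinal ni) _.
by apply/bigmax_ltP; split => // i _; exact: xy.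
Qed.

Lemma dyn_ball_center n x e : 0 < e -> dyn_ball f n x e x.
Proof. by move=> e0; apply/dyn_dist_ltP => // i _; rewrite mdistxx. Qed.

Lemma dyn_ball_diam n x y z e : 0 < e ->
  dyn_ball f n x e y -> dyn_ball f n x e z -> dyn_dist f n y z <= 2 * e.
Proof.
move=> e0 /dyn_dist_ltP xy /dyn_dist_ltP xz.
apply/dyn_dist_leP => [|i ni]; first by rewrite mulr_ge0// ltW.
apply: le_trans (metric_triangle _ (iter i f x) _) _.
by rewrite mulr2n mulrDl !mul1r lerD// ltW// ?xz// metric_sym xy.
Qed.

Lemma birkhoff_sum_cat psi n k x :
  birkhoff_sum f psi (n + k) x =
  birkhoff_sum f psi n x + birkhoff_sum f psi k (iter n f x).
Proof.
rewrite /birkhoff_sum big_split_ord /=; congr (_ + _).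
by apply: eq_bigr => i _; rewrite -iterD addnC.
Qed.

Lemma birkhoff_sumS psi n x :
  birkhoff_sum f psi n.+1 x = birkhoff_sum f psi n x + psi (iter n f x).
Proof. by rewrite /birkhoff_sum big_ord_recr. Qed.

Lemma birkhoff_sum_zero n x : birkhoff_sum f (fun=> 0) n x = 0.
Proof. by rewrite /birkhoff_sum big1. Qed.

Lemma birkhoff_sum_ge psi (m : R) n x :
  (forall y, m <= psi y) -> n%:R * m <= birkhoff_sum f psi n x.
Proof.
move=> mpsi; elim: n => [|n IH]; first by rewrite mul0r /birkhoff_sum big_ord0.
by rewrite birkhoff_sumS -natr1 mulrDl mul1r lerD.
Qed.

Lemma birkhoff_sum_le psi (M : R) n x :
  (forall y, psi y <= M) -> birkhoff_sum f psi n x <= n%:R * M.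
Proof.
move=> psiM; elim: n => [|n IH]; first by rewrite mul0r /birkhoff_sum big_ord0.
by rewrite birkhoff_sumS -natr1 mulrDl mul1r lerD.
Qed.

(** Two points that shadow each other for time [n] have Birkhoff sums that
    differ by at most one oscillation of [psi] per unit of time. *)
Lemma birkhoff_sum_osc psi (gamma delta e : R) n x y :
  (forall u v, mdist u v < delta -> `|psi u - psi v| <= gamma) ->
  0 <= e -> e < delta -> dyn_dist f n x y <= e ->
  birkhoff_sum f psi n x <= birkhoff_sum f psi n y + n%:R * gamma.
Proof.
move=> osc e0 ed /dyn_dist_leP -/(_ e0) xy.
rewrite -lerBlDl /birkhoff_sum -sumrB.
rewrite -[n in leRHS]card_ord -sum1_card natr_sum mulr_suml.
apply: ler_sum => i _; rewrite mul1r.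
apply: le_trans (ler_norm _) (osc _ _ _).
exact: le_lt_trans (xy _ (ltn_ord i)) ed.
Qed.

(** The exit sets of a level cover the space: the lower bound [m] makes the
    Birkhoff sums of every orbit cross the level [T], while the upper bound [M]
    delays the crossing, so that covers of large order arise from large [T]. *)
Lemma exit_setP psi (m M T : R) (N : nat) x :
  0 < m -> (forall y, m <= psi y) -> (forall y, psi y <= M) -> M <= T ->
  N%:R * M <= T ->
  exists n, [/\ (0 < n)%N, (N <= n)%N & exit_set f psi T n x].
Proof.
move=> m0 mpsi psiM MT NMT.
have M0 : 0 < M by exact: lt_le_trans m0 (le_trans (mpsi x) (psiM x)).
have ex : exists n, T < birkhoff_sum f psi n.+1 x.
  exists (Num.truncn (T / m)); apply: lt_le_trans (birkhoff_sum_ge _ _ mpsi).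
  by rewrite -ltr_pdivrMr// truncnS_gt.
case: (ex_minnP ex) => n nT nmin.
have n0 : (0 < n)%N.
  rewrite lt0n; apply/eqP => n0; move: nT; rewrite n0 ltNge.
  by rewrite (le_trans (birkhoff_sum_le _ _ psiM))// mul1r.
exists n; split => //.
  rewrite -ltnS -(ltr_nat R) -(ltr_pM2r M0); apply: le_lt_trans NMT _.
  by apply: lt_le_trans nT (birkhoff_sum_le _ _ psiM).
split => //; rewrite leNgt; apply/negP => Tn.
by have := nmin n.-1; rewrite prednK// => /(_ Tn); rewrite leqNgt ltn_predL n0.
Qed.

Lemma exit_times_le psi (m T : R) n :
  0 < m -> (forall y, m <= psi y) -> exit_times f psi T n -> n%:R <= T / m.
Proof.
move=> m0 mpsi [_ [x [xT _]]]; rewrite ler_pdivlMr//.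
exact: le_trans (birkhoff_sum_ge _ _ mpsi) xT.
Qed.

End Dynamics.

(** * The Carathéodory sums through listed centres *)

Section CentredCovers.
Context {R : realType} {X : metricType R} (f : X -> X) (psi : X -> R).
Implicit Types (s : seq (nat * X)) (p : nat * X) (e eta : R) (N : nat).

Definition centred_ball e p : set X := dyn_ball f p.1 p.2 e.

Definition centred_weight e p : R := ball_weight f psi (p.1, centred_ball e p).

(** A finite cover by dynamical balls, presented as a list of pairs of an order
    and a centre: unlike a finite set of balls, it can be mapped and
    concatenated, and it remembers the centres when the radius changes. *)
Definition centred_cover e N s : Prop :=
  (forall p, p \in s -> (0 < p.1)%N /\ (N <= p.1)%N) /\
  (forall x, exists2 p, p \in s & centred_ball e p x).

Definition cover_sum (alpha e : R) s : R :=
  \sum_(p <- s) expR (- alpha * centred_weight e p).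

Lemma BS_premeasure_ge0 alpha e N : (0 <= BS_premeasure f psi alpha e N)%E.
Proof.
apply: le_ereal_inf_tmp => _ [G [finG _ _] <-]; rewrite lee_fin fsbig_finite//.
by apply: sumr_ge0 => i _; exact: expR_ge0.
Qed.

Lemma BS_premeasure_nondecreasing alpha e :
  nondecreasing_seq (BS_premeasure f psi alpha e).
Proof.
move=> N N' NN'; apply: ereal_inf_le_tmp => _ [G [finG GN GX] <-].
exists G => //; split => // B /GN[B0 NB ?]; split => //.
exact: leq_trans NB.
Qed.

(** The BS dimension depends only on where the measure vanishes. A finite set of
    ordered balls becomes a list by choosing centres; conversely the set of
    balls of a list merges repeated terms, which can only lower the sum. *)
Lemma BS_measure_eq0P alpha e : [set: X] !=set0 ->
  BS_measure f psi alpha e = 0%E <->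
  (forall N eta, 0 < eta ->
     exists2 s, centred_cover e N s & cover_sum alpha e s < eta).
Proof.
move=> [x0 _]; set M := BS_premeasure f psi alpha e.
have limM : M @ \oo --> ereal_sup (range M).
  exact/ereal_nondecreasing_cvgn/BS_premeasure_nondecreasing.
split => [m0 N eta eta0|small].
  have : (M N < eta%:E)%E.
    apply: (@le_lt_trans _ _ 0%E); last by rewrite lte_fin.
    rewrite -m0 /BS_measure -/M (cvg_lim _ limM)//.
    by apply: ereal_sup_ubound; exists N.
  move=> /ereal_inf_lt[_ [G [finG GN GX] <-]]; rewrite lte_fin => Geta.
  have /choice[c cP] : forall B : nat * set X, exists x,
      ordered_balls f e N B -> B.2 = dyn_ball f B.1 x e.
    move=> B; have [[_ _ [x Bx]]|nB] := pselect (ordered_balls f e N B).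
      by exists x.
    by exists x0.
  have ballE B : B \in fset_set G -> centred_ball e (B.1, c B) = B.2.
    by rewrite in_fset_set// inE => /GN /cP.
  exists [seq (B.1, c B) | B <- fset_set G].
    split => [p /mapP[B]|x].
      by rewrite in_fset_set// inE => /GN[? ? _] ->.
    have : [set: X] x by [].
    rewrite -GX => -[B GB Bx]; exists (B.1, c B).
      by apply/mapP; exists B => //; rewrite in_fset_set// inE.
    by rewrite ballE// in_fset_set// inE.
  apply: le_lt_trans Geta; rewrite fsbig_finite// /cover_sum big_map.
  rewrite big_seq [leRHS]big_seq; apply: ler_sum => B GB.
  by rewrite /centred_weight ballE//= -surjective_pairing.
have M0 N : M N = 0%E.
  apply/eqP; rewrite eq_le BS_premeasure_ge0 andbT; apply/lee_addgt0Pr => /= eta eta0.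
  have [s [sN sX] seta] := small N eta eta0; rewrite add0e.
  pose ball p := (p.1, centred_ball e p).
  apply: ge_ereal_inf; exists (\sum_(B \in [set` map ball s])
    expR (- alpha * ball_weight f psi B))%:E; last first.
    rewrite lee_fin.
    have -> : [set` map ball s] = [set` undup (map ball s)].
      by apply/seteqP; split => B /=; rewrite mem_undup.
    rewrite -fsbig_seq ?undup_uniq//; apply: le_trans (ltW seta).
    apply: le_trans (sum_undup_le _ _) _ => [B|]; first exact: expR_ge0.
    by rewrite big_map.
  exists [set` map ball s] => //; split; first exact: finite_seq.
    move=> _ /= /mapP[p /sN[p0 Np] ->]; split => //.
    by exists p.2.
  apply/seteqP; split => // x _; have [p sp px] := sX x.
  by exists (ball p) => //=; exact: map_f.
rewrite /BS_measure -/M (_ : M = fun=> 0%E); last exact/funext.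
by apply: cvg_lim => //; exact: cvg_cst.
Qed.

Lemma ball_weight_ge (B : nat * set X) (M : R) x : (forall y, psi y <= M) ->
  B.2 x -> birkhoff_sum f psi B.1 x <= ball_weight f psi B.
Proof.
move=> psiM Bx; apply: ub_le_sup; last by exists x.
by exists (B.1%:R * M) => _ [y _ <-]; exact: birkhoff_sum_le.
Qed.

Lemma ball_weight_le (B : nat * set X) (w : R) : B.2 !=set0 ->
  (forall x, B.2 x -> birkhoff_sum f psi B.1 x <= w) -> ball_weight f psi B <= w.
Proof.
move=> [x Bx] Bw; apply: ge_sup => [|_ [y By <-]]; last exact: Bw.
by exists (birkhoff_sum f psi B.1 x), x.
Qed.

(** Enlarging the radius only increases the weights, so a cover by small balls
    yields a no larger sum for the concentric larger ones. *)
Lemma BS_measure_eq0_widen (alpha d e M : R) : [set: X] !=set0 ->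
  (forall y, psi y <= M) -> 0 < alpha -> 0 < d -> d <= e ->
  BS_measure f psi alpha d = 0%E -> BS_measure f psi alpha e = 0%E.
Proof.
move=> X0 psiM alpha0 d0 de; rewrite !BS_measure_eq0P// => small N eta eta0.
have ballS p : centred_ball d p `<=` centred_ball e p.
  by move=> x px; exact: lt_le_trans de.
have [s [sN sX] seta] := small N eta eta0; exists s.
  split => // x; have [p sp px] := sX x.
  by exists p => //; exact: ballS.
apply: le_lt_trans seta; apply: ler_sum => p _.
rewrite ler_expR !mulNr lerN2 ler_pM2l//.
apply: ball_weight_le => [|x px]; first by exists p.2; exact: dyn_ball_center.
apply: (@ball_weight_ge (p.1, centred_ball e p) M x psiM) => /=.
exact: ballS.
Qed.

Lemma BS_dim_at_ge0 e : (0 <= BS_dim_at f psi e)%E.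
Proof.
by apply: le_ereal_inf_tmp => _ [alpha [alpha0 _] <-]; rewrite lee_fin ltW.
Qed.

Lemma BS_dim_at_nonincreasing (d e M : R) : [set: X] !=set0 ->
  (forall y, psi y <= M) -> 0 < d -> d <= e ->
  (BS_dim_at f psi e <= BS_dim_at f psi d)%E.
Proof.
move=> X0 psiM d0 de; apply: ereal_inf_le_tmp => _ [alpha [alpha0 malpha] <-].
by exists alpha => //; split => //; exact: BS_measure_eq0_widen malpha.
Qed.

End CentredCovers.

(** * From spanning sets to covers *)

Section PressureAt.
Context {R : realType} {X : metricType R} (f : X -> X) (psi : X -> R).
Variables (m M : R).
Hypotheses (X_nonempty : [set: X] !=set0) (m_gt0 : 0 < m).
Hypotheses (psi_ge : forall x, m <= psi x) (psi_le : forall x, psi x <= M).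

Definition pressure_at (e : R) : \bar R :=
  limf_esup (fun T : R =>
    (T^-1)%:E * lne (pressure_sum f psi (fun=> 0%R) T e))%E (pinfty_nbhs R).

Lemma psi_bound_gt0 : 0 < M.
Proof.
by have [x _] := X_nonempty; exact: lt_le_trans m_gt0 (le_trans (psi_ge x) _).
Qed.

(** For the zero potential the pressure sum counts pairs of an exit time and a
    point of the spanning set chosen at that time. *)
Lemma esum_zero_potential (S : set nat) (F : nat -> set X) :
  (\esum_(n in S) \esum_(x in F n) (expR (birkhoff_sum f (fun=> 0%R) n x))%:E =
   \esum_(p in S `*`` F) 1%:E)%E.
Proof.
rewrite -(@esum_esum _ _ _ _ _ (fun _ _ => 1%:E)); last first.
  by move=> *; rewrite lee_fin.
by apply: eq_esum => n _; apply: eq_esum => x _; rewrite birkhoff_sum_zero expR0.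
Qed.

Lemma pressure_sum_ge1 T e : M <= T ->
  (1 <= pressure_sum f psi (fun=> 0%R) T e)%E.
Proof.
move=> MT; apply: le_ereal_inf_tmp => _ [F Fspan <-].
have [x _] := X_nonempty.
have T0 : 0%:R * M <= T by rewrite mul0r (le_trans (ltW psi_bound_gt0)).
have [n [n0 _ xn]] := exit_setP f x m_gt0 psi_ge psi_le MT T0.
have nT : exit_times f psi T n by split => //; exists x.
have [y Fy _] := Fspan n nT x xn.
rewrite esum_zero_potential; apply: esum_ge; exists [set (n, y)].
  by split => // _ ->.
by rewrite fsbig_set1.
Qed.

Lemma pressure_sum_nonincreasing T d e : d <= e ->
  (pressure_sum f psi (fun=> 0%R) T e <= pressure_sum f psi (fun=> 0%R) T d)%E.
Proof.
move=> de; apply: ereal_inf_le_tmp => _ [F Fspan <-]; exists F => // n nT y yn.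
by have [x Fx xy] := Fspan n nT y yn; exists x => //; exact: le_trans de.
Qed.

Lemma pressure_at_nonincreasing d e : d <= e -> (pressure_at e <= pressure_at d)%E.
Proof.
move=> de; apply: le_limf_esup_near; near=> T.
have T0 : 0 < T by near: T; exact: nbhs_pinfty_gt.
have MT : M <= T by near: T; apply: nbhs_pinfty_ge; exact: num_real.
rewrite lee_pmul2l ?fin_numE//; last by rewrite lte_fin invr_gt0.
have Q0 c : pressure_sum f psi (fun=> 0%R) T c \in `[0%E, +oo%E].
  by rewrite in_itv/= leey andbT (le_trans _ (pressure_sum_ge1 c MT))// lee_fin.
by rewrite lee_lne ?Q0//; exact: pressure_sum_nonincreasing.
Unshelve. all: by end_near. Qed.

Lemma pressure_at_ge0 e : (0 <= pressure_at e)%E.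
Proof.
apply: limf_esup_ge_near; near=> T.
have T0 : 0 < T by near: T; exact: nbhs_pinfty_gt.
have MT : M <= T by near: T; apply: nbhs_pinfty_ge; exact: num_real.
apply: mule_ge0; first by rewrite lee_fin invr_ge0 ltW.
by rewrite lne_ge0 pressure_sum_ge1.
Unshelve. all: by end_near. Qed.

(** A family of spanning sets at level [T] is a cover whose balls all have
    weight at least [T - M]: every useful centre shadows a point that leaves the
    level within one step. Hence its Carathéodory sum is at most
    [expR (s * T) * expR (- alpha * (T - M))], which vanishes as [T] grows. *)
Lemma pressure_at_lt_BS_measure (d e s alpha : R) : 0 <= d -> d < e -> 0 < alpha ->
  s < alpha -> (pressure_at d < s%:E)%E -> BS_measure f psi alpha e = 0%E.
Proof.
move=> d0 de alpha0 salpha Ps; apply/BS_measure_eq0P => // N eta eta0.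
have /filter_ex[T [[T0 MT NMT] [Tbig]]] : \forall T \near +oo,
    [/\ 0 < T, M <= T & N%:R * M <= T] /\
    (alpha * M - ln eta) / (alpha - s) < T /\
    ((T^-1)%:E * lne (pressure_sum f psi (fun=> 0%R) T d) < s%:E)%E.
  near=> T; split; [split|split]; near: T.
  - exact: nbhs_pinfty_gt.
  - by apply: nbhs_pinfty_ge; exact: num_real.
  - by apply: nbhs_pinfty_ge; exact: num_real.
  - by apply: nbhs_pinfty_gt; exact: num_real.
  - exact: limf_esup_lt_near.
rewrite lte_pdivrMl// -EFinM lne_ltP => /ereal_inf_lt[_ [F Fspan <-]].
rewrite esum_zero_potential => /ltW/esum1_le_finite[t tE sizet].
(* Centres far from the exit set are dropped: their balls could have a small
   weight. *)
pose near_exit p := `[< exists2 y, exit_set f psi T p.1 y &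
                        dyn_dist f p.1 p.2 y <= d >].
have tP p : p \in t -> (0 < p.1)%N.
  by move=> pt; have : [set` t] p by []; rewrite -tE => -[[]].
exists ([seq p <- t | near_exit p]).
  split => [p|x].
    rewrite mem_filter => /andP[/asboolP[y [_ Ty] _] pt].
    split; first exact: tP.
    rewrite -ltnS -(ltr_nat R) -(ltr_pM2r psi_bound_gt0).
    by apply: le_lt_trans NMT (lt_le_trans Ty _); exact: birkhoff_sum_le.
  have [n [n0 _ xn]] := exit_setP f x m_gt0 psi_ge psi_le MT NMT.
  have nT : exit_times f psi T n by split => //; exists x.
  have [z Fz zx] := Fspan n nT x xn.
  exists (n, z); last exact: le_lt_trans de.
  rewrite mem_filter; apply/andP; split; first by apply/asboolP; exists x.
  by have : (exit_times f psi T `*`` F) (n, z) by []; rewrite tE.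
have weight_ge p : p \in [seq p <- t | near_exit p] ->
    T - M <= centred_weight f psi e p.
  rewrite mem_filter => /andP[/asboolP[y [_ Ty] py] _].
  apply: (@le_trans _ _ (birkhoff_sum f psi p.1 y)).
    rewrite lerBlDr ltW// (lt_le_trans Ty)// birkhoff_sumS lerD2l.
    exact: psi_le.
  apply: (@ball_weight_ge _ _ _ _ (p.1, centred_ball f e p) M y psi_le) => /=.
  exact: le_lt_trans de.
apply: (@le_lt_trans _ _ ((size [seq p <- t | near_exit p])%:R *
                          expR (- alpha * (T - M)))).
  apply: ler_sum_const => p pt.
  by rewrite ler_expR !mulNr lerN2 ler_pM2l// weight_ge.
apply: (@le_lt_trans _ _ (expR (T * s) * expR (- alpha * (T - M)))).
  rewrite ler_wpM2r ?expR_ge0// (le_trans _ sizet)// ler_nat size_filter.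
  exact: count_size.
(* [T] was chosen so that [T * s - alpha * (T - M) < ln eta]. *)
rewrite -expRD -[ltRHS](@lnK _ eta)// ltr_expR.
move: Tbig; rewrite ltr_pdivrMr ?subr_gt0// => Tbig; lra.
Unshelve. all: by end_near. Qed.

Lemma BS_dim_at_le_pressure_at (d e : R) : 0 <= d -> d < e ->
  (BS_dim_at f psi e <= pressure_at d)%E.
Proof.
move=> d0 de; have := pressure_at_ge0 d.
case Pd : (pressure_at d) => [r| |]; rewrite ?leey ?lee_fin// => r0.
apply/lee_addgt0Pr => h h0; apply: ereal_inf_lbound.
exists (r + h) => //; split; first by rewrite ltr_wpDl.
apply: (@pressure_at_lt_BS_measure d e (r + h / 2)) => //.
- by rewrite ltr_wpDl.
- by rewrite ltrD2l ltr_pdivrMr// ltr_pMr// ltr1n.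
- by rewrite Pd lte_fin ltrDl divr_gt0.
Qed.

End PressureAt.

(** * From covers to spanning sets *)

Section Concatenation.
Context {R : realType} {X : metricType R} (f : X -> X) (psi : X -> R).
Variable m : R.
Hypotheses (X_nonempty : [set: X] !=set0) (m_gt0 : 0 < m).
Hypothesis psi_ge : forall x, m <= psi x.

(** Covers by sets of small diameter, rather than spanning sets, are the right
    count to propagate along orbits: pulling back and intersecting keeps the
    diameter, whereas moving centres would double the radius at each step. *)
Definition small_cover (n : nat) (r : R) (Z : set X) (C : seq (set X)) : Prop :=
  (forall A x y, A \in C -> A x -> A y -> dyn_dist f n x y <= r) /\
  (forall x, Z x -> exists2 A, A \in C & A x).

Lemma small_cover_spanning n r Z C : small_cover n r Z C ->
  exists2 t : seq X, spanning_set f n r Z [set` t] & (size t <= size C)%N.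
Proof.
move=> [Csmall CZ]; have [x0 _] := X_nonempty.
have /choice[c cP] : forall A : set X, exists x, A !=set0 -> A x.
  move=> A; have [[x Ax]|nA] := pselect (A !=set0); first by exists x.
  by exists x0.
exists (map c C); last by rewrite size_map.
move=> y /CZ[A CA Ay]; exists (c A); first exact: map_f.
by apply: (Csmall A) => //; apply: cP; exists y.
Qed.

(** The dynamical balls of a cover [s] with Carathéodory sum at most 1 are used
    as letters: the itinerary of a point through them determines its orbit
    segment up to [2 * e]. By induction on the length [n], removing the first
    letter [p] lowers the allowed level of the Birkhoff sum by the weight of
    [p], up to the oscillation [gamma] of [psi] on each unit of time, so the
    counts satisfy the renewal inequality
    [N n t <= \sum_p N (n - p.1) (t - weight p + gamma * p.1)], whose solution
    is exponential because the sum is at most 1. The constant [K] absorbs the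
    last letter, which may overshoot time [n]. *)
Lemma sublevel_small_cover (e gamma alpha delta K : R) (s : seq (nat * X)) :
  0 < e -> 2 * e < delta -> 0 <= gamma -> 0 <= alpha ->
  (forall u v, mdist u v < delta -> `|psi u - psi v| <= gamma) ->
  centred_cover f e 0 s -> cover_sum f psi alpha e s <= 1 ->
  (forall p, p \in s -> centred_weight f psi e p <= K) ->
  forall (n : nat) (t : R), exists2 C : seq (set X),
    small_cover n (2 * e) [set x | birkhoff_sum f psi n x <= t] C &
    (size C)%:R <= expR (alpha * (t + gamma * n%:R + K)).
Proof.
move=> e0 edelta gamma0 alpha0 osc [s_gt0 sX] ssum sK.
have e20 : 0 <= 2 * e by rewrite mulr_ge0// ltW.
elim/ltn_ind => n IH t.
have [t0|t0] := ltP t 0.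
  exists [::]; last exact: expR_ge0.
  split => // x /= xt; have := birkhoff_sum_ge f n x psi_ge.
  move=> /le_trans/(_ xt)/le_lt_trans/(_ t0).
  by rewrite ltNge mulr_ge0// ltW.
pose E := expR (alpha * (t + gamma * n%:R + K)).
have /choice[C CP] : forall p : nat * X, exists C : seq (set X), p \in s ->
    small_cover n (2 * e)
      [set x | centred_ball f e p x /\ birkhoff_sum f psi n x <= t] C /\
    (size C)%:R <= E * expR (- alpha * centred_weight f psi e p).
  move=> p; have [ps|_] := boolP (p \in s); last by exists [::].
  set w := centred_weight f psi e p.
  have [np|pn] := leqP n p.1.
    (* The letter [p] alone reaches time [n]. *)
    exists [:: centred_ball f e p] => _; split; last first.
      rewrite -expRD /=; apply: le_trans (expR_ge1Dx _); rewrite lerDl.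
      have := sK p ps; rewrite -/w => wK.
      have -> : alpha * (t + gamma * n%:R + K) + - alpha * w =
                alpha * (t + gamma * n%:R + (K - w)) by ring.
      apply: mulr_ge0 => //; apply: addr_ge0; last by rewrite subr_ge0.
      by apply: addr_ge0 => //; exact: mulr_ge0.
    split => [A x y|x [px _]]; last by exists (centred_ball f e p); rewrite ?mem_head.
    rewrite inE => /eqP -> px py.
    have /(dyn_dist_leP _ _ _ _ e20) xy := dyn_ball_diam e0 px py.
    by apply/dyn_dist_leP => // i ni; apply: xy; exact: leq_trans np.
  have [p0 _] := s_gt0 p ps.
  have np_lt : (n - p.1 < n)%N by rewrite ltn_subrL p0 (leq_trans p0 (ltnW pn)).
  have [C [Csmall CZ] Csize] := IH _ np_lt (t - w + gamma * p.1%:R).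
  exists [seq centred_ball f e p `&` (iter p.1 f @^-1` A) | A <- C] => _; split.
    split => [_ x y /mapP[A CA ->] [px /= Ax] [py /= Ay]|x [px xt]].
      apply/dyn_dist_leP => // i ni; have [ip|pi] := ltnP i p.1.
        have /(dyn_dist_leP _ _ _ _ e20) := dyn_ball_diam e0 px py.
        exact.
      have /(dyn_dist_leP _ _ _ _ e20) := Csmall A _ _ CA Ax Ay.
      move=> /(_ (i - p.1)%N); rewrite -!iterD subnK//; apply.
      by rewrite ltn_sub2r.
    have wx : w <= birkhoff_sum f psi p.1 x + p.1%:R * gamma.
      apply: ball_weight_le => [|y py]; first by exists x.
      apply: (birkhoff_sum_osc osc e20 edelta).
      exact: dyn_ball_diam e0 py px.
    have [|A CA Ax] := CZ (iter p.1 f x).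
      move: xt; rewrite /= -{1}(subnKC (ltnW pn)) birkhoff_sum_cat; lra.
    exists (centred_ball f e p `&` (iter p.1 f @^-1` A)) => //.
    by apply/mapP; exists A.
  rewrite size_map (le_trans Csize)// -expRD ler_expR.
  rewrite natrB ?(ltnW pn)//.
  lra.
exists (flatten [seq C p | p <- s]).
  split => [A x y /flatten_mapP[p ps CA]|x xt].
    by have [[Csmall _] _] := CP p ps; exact: Csmall.
  have [p ps px] := sX x; have [[_ CZ] _] := CP p ps.
  have [//|A CA Ax] := CZ x; exists A => //.
  by apply/flatten_mapP; exists p.
rewrite size_flatten sumnE /shape -map_comp big_map natr_sum.
apply: (@le_trans _ _ (E * cover_sum f psi alpha e s)); last first.
  by rewrite ler_piMr ?expR_ge0.
rewrite mulr_sumr big_seq [leRHS]big_seq; apply: ler_sum => p ps.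
by have [_] := CP p ps.
Qed.

(** There are at most [T / m] exit times, and the exit set at each of them lies
    in a sublevel set of the Birkhoff sum. *)
Lemma pressure_at_le_BS_measure (e gamma alpha delta : R) :
  0 < e -> 2 * e < delta -> 0 < gamma -> 0 < alpha ->
  (forall u v, mdist u v < delta -> `|psi u - psi v| <= gamma) ->
  BS_measure f psi alpha e = 0%E ->
  (pressure_at f psi (2 * e) <= (alpha * (1 + gamma / m))%:E)%E.
Proof.
move=> e0 edelta gamma0 alpha0 osc /BS_measure_eq0P -/(_ X_nonempty 0%N 1 ltr01).
move=> [s scov /ltW ssum].
pose K := \big[Num.max/0]_(p <- s) centred_weight f psi e p.
have sK p : p \in s -> centred_weight f psi e p <= K.
  by move=> ps; exact: le_bigmax_seq.
have cover := sublevel_small_cover e0 edelta (ltW gamma0) (ltW alpha0) osc scov ssum sK.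
(* The margin [eta] absorbs the number of exit times, which is linear in [T], and
   the constant factor [expR (alpha * K)]. *)
apply/lee_addgt0Pr => eta eta0; apply: limf_esup_le_near; near=> T.
have T0 : 0 < T by near: T; exact: nbhs_pinfty_gt.
have Tm : 0 <= T / m by rewrite divr_ge0// ltW.
have Tbig : (m^-1 * T + 1) * expR (alpha * K) <= expR (eta * T).
  near: T; apply: near_affine_le_expR => //.
  by rewrite invr_ge0 ltW.
rewrite -EFinD lee_pdivrMl// -EFinM lne_leP.
pose E := expR (alpha * (T + gamma * (T / m) + K)).
have /choice[t tP] : forall n, exists t : seq X, exit_times f psi T n ->
    spanning_set f n (2 * e) (exit_set f psi T n) [set` t] /\ (size t)%:R <= E.
  move=> n; have [nT|nT] := pselect (exit_times f psi T n); last by exists [::].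
  have [C Ccov Csize] := cover n T.
  have [t tspan tC] := small_cover_spanning Ccov.
  exists t => _; split; first by move=> y [yT _]; exact: tspan.
  apply: le_trans (_ : (size C)%:R <= _); first by rewrite ler_nat.
  rewrite (le_trans Csize)// ler_expR ler_pM2l// lerD2r lerD2l ler_pM2l//.
  exact: exit_times_le nT.
apply: (@le_trans _ _ (((Num.truncn (T / m)).+1)%:R * E)%:E).
  apply: ge_ereal_inf; eexists.
    by exists (fun n => [set` t n]) => // n /tP[].
  rewrite -[X in X%:R](size_iota 0).
  apply: esum_le_card => [n nT||n nT].
  - suff : n \in iota 0 (Num.truncn (T / m)).+1 by [].
    rewrite mem_iota leq0n add0n -(ltr_nat R).
    apply: le_lt_trans (exit_times_le m_gt0 psi_ge nT) _.
    exact: truncnS_gt.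
  - exact: expR_ge0.
  - rewrite (@eq_esum _ _ _ _ (fun=> 1%:E)); last first.
      by move=> x _; rewrite birkhoff_sum_zero expR0.
    apply: le_trans (esum_le_card (t := t n) (c := 1) _ _ _) _ => //.
    by rewrite mulr1 lee_fin; have [] := tP n nT.
rewrite lee_fin.
apply: (@le_trans _ _ ((m^-1 * T + 1) * E)).
  by rewrite ler_wpM2r ?expR_ge0// -natr1 lerD2r [leRHS]mulrC truncn_le.
have -> : E = expR (alpha * K) * expR (T * (alpha * (1 + gamma / m))).
  by rewrite -expRD; congr expR; field; rewrite gt_eqF.
rewrite [T * (_ + eta)]mulrDr expRD [leRHS]mulrC [leLHS]mulrA.
by rewrite ler_pM2r ?expR_gt0// [T * eta]mulrC.
Unshelve. all: by end_near. Qed.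

End Concatenation.

(** * Equality of the two quantities *)

Theorem proposition4p1 (R : realType) (X : metricType R) (f : X -> X)
    (psi : X -> R)
    (X_nonempty : [set: X] !=set0) (X_compact : compact [set: X])
    (f_cont : continuous f)
    (psi_cont : continuous psi) (psi_gt0 : forall x, 0 < psi x) :
  induced_pressure f psi (fun=> 0) = BS_dim f psi.
Proof.
have psi_within : {within [set: X], continuous psi} by exact: continuous_subspaceT.
have [a _ psi_a] := compact_EVT_min X_nonempty X_compact psi_within.
have [b _ psi_b] := compact_EVT_max X_nonempty X_compact psi_within.
have {}psi_a x : psi a <= psi x by apply: psi_a; rewrite inE.
have {}psi_b x : psi x <= psi b by apply: psi_b; rewrite inE.
have m0 := psi_gt0 a.
have pressureE : induced_pressure f psi (fun=> 0) =
    ereal_sup (pressure_at f psi @` [set e | 0 < e]).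
  apply: (@lim_nonincreasing_at_right0 _ (pressure_at f psi)) => d e d0.
  exact: pressure_at_nonincreasing X_nonempty m0 psi_a psi_b _ _.
have dimE : BS_dim f psi = ereal_sup (BS_dim_at f psi @` [set e | 0 < e]).
  apply: lim_nonincreasing_at_right0 => d e.
  exact: BS_dim_at_nonincreasing X_nonempty psi_b.
apply/eqP; rewrite eq_le; apply/andP; split; last first.
  rewrite dimE pressureE; apply: ge_ereal_sup => _ [e /= e0 <-].
  apply: le_trans (_ : pressure_at f psi (e / 2) <= _)%E.
    apply: BS_dim_at_le_pressure_at X_nonempty m0 psi_a psi_b _ _ _ _.
      by rewrite divr_ge0// ltW.
    by rewrite ltr_pdivrMr// ltr_pMr// ltr1n.
  by apply: ereal_sup_ubound; exists (e / 2) => //=; rewrite divr_gt0.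
have dim_ge e : 0 < e -> (BS_dim_at f psi e <= BS_dim f psi)%E.
  by move=> e0; rewrite dimE; apply: ereal_sup_ubound; exists e.
have : (0 <= BS_dim f psi)%E.
  exact: le_trans (BS_dim_at_ge0 f psi 1) (dim_ge 1 ltr01).
case D : (BS_dim f psi) => [r| |]; rewrite ?leey ?lee_fin// => r0.
rewrite pressureE; apply: ge_ereal_sup => _ [e0 /= e0_gt0 <-].
apply/lee_addgt0Pr => h h0; rewrite -EFinD.
(* Half of the margin [h] pays for choosing [alpha] above the dimension, the
   other half for the factor [1 + gamma / m]. *)
pose c := r + h / 2; have c0 : 0 < c by rewrite ltr_wpDl// divr_gt0.
pose gamma := psi a * (h / 2) / c.
have gamma0 : 0 < gamma by rewrite divr_gt0// mulr_gt0// divr_gt0.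
have [delta delta0 osc] := compact_uniform_continuity X_compact psi_cont gamma0.
pose e := Num.min (e0 / 2) (delta / 3).
have e_gt0 : 0 < e by rewrite lt_min !divr_gt0.
have ee0 : 2 * e <= e0.
  by rewrite mulrC -ler_pdivlMr// ge_min lexx.
have edelta : 2 * e < delta.
  rewrite mulrC -ltr_pdivlMr// gt_min; apply/orP; right.
  by rewrite ltr_pM2l// ltf_pV2 ?posrE// ltr_nat.
have /ereal_inf_lt[_ [alpha [alpha0 malpha] <-]] : (BS_dim_at f psi e < c%:E)%E.
  by apply: le_lt_trans (dim_ge e e_gt0) _; rewrite D lte_fin ltrDl divr_gt0.
rewrite lte_fin => alphac.
apply: le_trans (pressure_at_nonincreasing f X_nonempty m0 psi_a psi_b ee0) _.
apply: le_trans (pressure_at_le_BS_measure X_nonempty m0 psi_a e_gt0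
  edelta gamma0 alpha0 osc malpha) _.
rewrite lee_fin; apply: (@le_trans _ _ (c * (1 + gamma / psi a))).
  by rewrite ler_wpM2r ?ltW// addr_gt0// divr_gt0.
have -> : c * (1 + gamma / psi a) = c + h / 2.
  by rewrite /gamma; field; rewrite !gt_eqF.
by rewrite /c; lra.
Qed.
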